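(* The Maximum Transitivity Problem can be solved in linear time (i.e. in $O(n+m)$ time, where $n$ and $m$ are the numbers of vertices and edges) for split graphs: given a split graph $G$, $Tr(G)$ (together with a transitive partition of that order) can be computed in linear time.
   Context: All graphs are finite and simple. For disjoint $A,B\subseteq V$, $A$ dominates $B$ if every vertex of $B$ is adjacent to at least one vertex of $A$. A transitive $k$-partition of $G=(V,E)$ is a partition $\{V_1,\dots,V_k\}$ of $V$ into $k$ nonempty parts such that $V_i$ dominates $V_j$ for all $1\le i<j\le k$. The transitivity $Tr(G)$ is the maximum $k$ for which a transitive $k$-partition exists. The Maximum Transitivity Problem asks, for a given graph, for a transitive partition with the maximum number of parts (equivalently, its order $Tr(G)$). A split graph is a graph whose vertex set can be partitioned into an independent set and a clique. *)

(* Defs.v *)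
From mathcomp Require Import all_boot.
Set Implicit Arguments.
Unset Strict Implicit.
Unset Printing Implicit Defensive.

Definition split_graph (T : finType) (e : rel T) : bool :=
  [exists I : {set T},
     [forall x in I, forall y in I, ~~ e x y]
  && [forall x in ~: I, forall y in ~: I, (x != y) ==> e x y]].

Definition edges (T : finType) (e : rel T) : {set {set T}} :=
  [set [set x; y] | x in T, y in T & e x y].

Definition dominates (T : finType) (e : rel T) (A B : {set T}) : bool :=
  [forall y in B, exists x in A, e x y].

(* The parts are listed in order; [partition] only sees the set of parts (and
   requires them to be nonempty), whence [uniq]. *)
Definition transitive_partition (T : finType) (e : rel T)
    (V : seq {set T}) : bool :=
  [&& uniq V, partition [set A in V] [set: T] & pairwise (dominates e) V].

(* The bound on k is harmless: the parts are nonempty and disjoint. *)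
Definition transitivity (T : finType) (e : rel T) : nat :=
  \max_(k < #|T|.+1 |
      [exists V : k.-tuple {set T}, transitive_partition e V]) k.

(* Word RAM, presented as structured programs. The store consists of registers
   and of arrays, both indexed by nat; a given program mentions only finitely
   many of them. *)
Record state := State { reg : nat -> nat; arr : nat -> nat -> nat }.

Definition upd (A : Type) (f : nat -> A) (i : nat) (v : A) : nat -> A :=
  fun j => if j == i then v else f j.

Definition set_reg (s : state) (x v : nat) : state :=
  State (upd (reg s) x v) (arr s).

Definition set_arr (s : state) (a i v : nat) : state :=
  State (reg s) (upd (arr s) a (upd (arr s a) i v)).

Inductive cmd :=
| Skip
| Const (x c : nat)          (* r_x := c *)
| Move (x y : nat)           (* r_x := r_y *)
| Add (x y z : nat)          (* r_x := r_y + r_z *)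
| Sub (x y z : nat)          (* r_x := r_y - r_z, truncated at 0 *)
| Read (x a y : nat)         (* r_x := a[r_y] *)
| Write (a x y : nat)        (* a[r_x] := r_y *)
| Seq (p q : cmd)
| If (x y : nat) (p q : cmd) (* if r_x < r_y then p else q *)
| While (x y : nat) (p : cmd). (* while r_x < r_y do p *)

(* [exec w p s t s']: started in s, the program p halts in s' after exactly t
   unit-cost operations (assignments and tests). No value w or larger may be
   created: an overflowing computation is stuck. Without such a bound on the
   word size, unit-cost additions would build numbers of exponential size. *)
Inductive exec (w : nat) : cmd -> state -> nat -> state -> Prop :=
| exec_skip s : exec w Skip s 1 s
| exec_const x c s : c < w -> exec w (Const x c) s 1 (set_reg s x c)
| exec_move x y s : exec w (Move x y) s 1 (set_reg s x (reg s y))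
| exec_add x y z s : reg s y + reg s z < w ->
    exec w (Add x y z) s 1 (set_reg s x (reg s y + reg s z))
| exec_sub x y z s :
    exec w (Sub x y z) s 1 (set_reg s x (reg s y - reg s z))
| exec_read x a y s :
    exec w (Read x a y) s 1 (set_reg s x (arr s a (reg s y)))
| exec_write a x y s :
    exec w (Write a x y) s 1 (set_arr s a (reg s x) (reg s y))
| exec_seq p q s1 s2 s3 t1 t2 :
    exec w p s1 t1 s2 -> exec w q s2 t2 s3 ->
    exec w (Seq p q) s1 (t1 + t2) s3
| exec_if x y p q s t s' :
    exec w (if reg s x < reg s y then p else q) s t s' ->
    exec w (If x y p q) s t.+1 s'
| exec_while_stop x y p s :
    reg s y <= reg s x -> exec w (While x y p) s 1 s
| exec_while_step x y p s1 s2 s3 t1 t2 :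
    reg s1 x < reg s1 y ->
    exec w p s1 t1 s2 -> exec w (While x y p) s2 t2 s3 ->
    exec w (While x y p) s1 (t1 + t2).+1 s3.

(* The lists may enumerate the neighbours in any order. *)
Definition adjacency_lists n (e : rel 'I_n) (L : 'I_n -> seq 'I_n) : Prop :=
  forall u, uniq (L u) /\ L u =i e u.

(* Register 0 holds n; array 1 is the concatenation of the adjacency lists of
   0, ..., n-1; array 0 holds the offsets, so that the list of u occupies the
   cells of array 1 from offset u (included) to offset u.+1 (excluded). All
   other cells hold 0. *)
Definition input n (L : 'I_n -> seq 'I_n) : state :=
  State (fun x => if x == 0 then n else 0)
        (fun a i =>
           if a == 0 then
             if i <= n then \sum_(u < n | u < i) size (L u) else 0
           else if a == 1 then
             nth 0 [seq val v | v <- flatten [seq L u | u <- enum 'I_n]] i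
           else 0).

(* The number of parts is read in register 0, and cell v of array 2 holds the
   rank, counted from 0, of the part containing v. *)
Definition output_parts n (s : state) : seq {set 'I_n} :=
  [seq [set v : 'I_n | arr s 2 v == i] | i <- iota 0 (reg s 0)].

(* Main.v *)
Require Import Defs.
From mathcomp Require Import all_boot zify.
Set Implicit Arguments. Unset Strict Implicit. Unset Printing Implicit Defensive.

(** Let h be the h-index of the degree sequence: the largest h such that at
    least h vertices have degree at least h. On a nonempty split graph the
    transitivity is h + 1. For the upper bound, every part except possibly one
    (the part included in the independent side, if there is one) contains a
    vertex with a neighbour in each of the other parts; so a transitive
    k-partition yields k - 1 vertices of degree at least k - 1. For the lower
    bound, let Q consist of h vertices of largest degree. Q is a clique, and a
    vertex of Q has degree at least h but at most h - 1 neighbours in Q, hence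
    a neighbour outside Q; so the complement of Q, followed by the singletons
    of Q, is a transitive partition. The offsets of the adjacency lists give
    the degrees, and counting them gives h and Q in O(n) steps; no split
    partition is ever computed. *)

(** * Counting the parts of a partition *)

(** Disjointness makes each part counted by [C] the block of some element of [X], so there are at
    most as many such parts as elements. *)
Lemma count_meeting (T : finType) (V : seq {set T}) (C : pred {set T})
    (X : {set T}) :
  uniq V -> trivIset [set A in V] ->
  (forall A, A \in V -> C A -> exists2 x, x \in A & x \in X) ->
  count C V <= #|X|.
Proof.
move=> uV tV meet; rewrite -size_filter -(card_uniqP (filter_uniq C uV)).
apply: leq_trans (leq_imset_card (pblock [set A in V]) X).
apply/subset_leq_card/subsetP => A; rewrite mem_filter => /andP[CA AV].
have [x xA xX] := meet A AV CA.
by apply/imsetP; exists x; rewrite // (def_pblock tV _ xA) ?inE.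
Qed.

Lemma dominates_index (T : finType) (e : rel T) (V : seq {set T}) A B :
  pairwise (dominates e) V -> A \in V -> B \in V -> index A V < index B V ->
  dominates e A B.
Proof.
move=> /(pairwiseP set0) domV AV BV ltAB.
by rewrite -(nth_index set0 AV) -(nth_index set0 BV) domV // inE index_mem.
Qed.

(** * Transitive partitions of split graphs *)

Section SplitGraph.

Variables (T : finType) (e : rel T).
Hypotheses (sym_e : symmetric e) (irr_e : irreflexive e).
Hypothesis split_e : split_graph e.

Lemma split_graphP : exists I : {set T},
  {in I &, forall x y, ~~ e x y} /\
  {in ~: I &, forall x y, x != y -> e x y}.
Proof.
have /existsP[I /andP[/forall_inP indep /forall_inP clique]] := split_e.
exists I; split=> x y xI yI; first exact: (forall_inP (indep x xI)).
exact/implyP/(forall_inP (clique x xI)).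
Qed.

(** If some part lies in the independent side [I], it is the only one, and it serves as [B0]: an
    independent part cannot dominate another. Every remaining part contains a clique vertex, and
    clique vertices of distinct parts are adjacent. *)
Lemma transitive_partition_all_but_one (V : seq {set T}) :
  transitive_partition e V ->
  exists B0, forall A, A \in V -> A != B0 ->
    exists2 x, x \in A &
      forall B, B \in V -> B != A -> exists2 y, y \in B & y \in e x.
Proof.
case/and3P=> uV /and3P[_ tV nV0] domV.
have [I [indep clique]] := split_graphP.
have disjV A B x : A \in V -> B \in V -> x \in A -> x \in B -> A = B.
  move=> AV BV xA xB; rewrite -(def_pblock tV _ xA) ?inE //.
  by rewrite (def_pblock tV _ xB) ?inE.
(* Earlier parts dominate [A], so any vertex of [A] has a neighbour in each of them; only the later
   parts have to be checked. *)
have later A x : A \in V -> x \in A ->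
    (forall B, B \in V -> index A V < index B V ->
      exists2 y, y \in B & y \in e x) ->
    forall B, B \in V -> B != A -> exists2 y, y \in B & y \in e x.
  move=> AV xA nbr B BV neqBA.
  have [ltAB|leBA] := ltnP (index A V) (index B V); first exact: nbr.
  have ltBA : index B V < index A V.
    rewrite ltn_neqAle leBA andbT; apply: contraNneq neqBA.
    by move/(index_inj set0 BV AV) => ->.
  have /forall_inP/(_ x xA)/exists_inP[y yB eyx] :=
    dominates_index domV BV AV ltBA.
  by exists y; rewrite // unfold_in sym_e.
have cliqueV A B x y : A \in V -> B \in V -> B != A ->
    x \in A :\: I -> y \in B :\: I -> e x y.
  move=> AV BV neqBA; rewrite !in_setD => /andP[xI xA] /andP[yI yB].
  apply: clique; rewrite ?in_setC //; apply: contraNneq neqBA => eqxy.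
  by rewrite (disjV A B x) // eqxy.
have neq_index A B : index A V < index B V -> B != A.
  by apply: contraTneq => ->; rewrite ltnn.
have [/hasP[B0 B0V B0I]|/hasPn meetI] := boolP (has (fun B : {set T} => B \subset I) V).
  have meetI A : A \in V -> A != B0 -> exists x, x \in A :\: I.
    move=> AV neqA; apply/set0Pn; rewrite setD_eq0; apply/negP => AI.
    have dom2 B1 B2 : B1 \in V -> B2 \in V -> B1 \subset I -> B2 \subset I ->
        index B1 V < index B2 V -> False.
      move=> B1V B2V /subsetP B1I /subsetP B2I lt12.
      have /set0Pn[y yB2] : B2 != set0.
        by apply: contraNneq nV0 => <-; rewrite inE.
      have /forall_inP/(_ y yB2)/exists_inP[x xB1] :=
        dominates_index domV B1V B2V lt12.
      by apply/negP/indep; [apply: B1I|apply: B2I].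
    case: (ltngtP (index A V) (index B0 V)); [exact: dom2|exact: dom2|].
    by move/(index_inj set0 AV B0V)/eqP; rewrite (negPf neqA).
  exists B0 => A AV neqA.
  (* If [A] precedes [B0], take in [A] a neighbour of a vertex of [B0]: it is outside [I], hence
     also adjacent to the clique vertices of the other parts. Otherwise any clique vertex of [A]
     works, since [B0] is not among the later parts. *)
  have [ltA|leA] := ltnP (index A V) (index B0 V).
    have /set0Pn[z zB0] : B0 != set0.
      by apply: contraNneq nV0 => <-; rewrite inE.
    have /forall_inP/(_ z zB0)/exists_inP[x xA exz] :=
      dominates_index domV AV B0V ltA.
    have xI : x \in A :\: I.
      rewrite in_setD xA andbT; apply/negP => xI.
      by move/negP: (indep _ _ xI (subsetP B0I z zB0)).
    exists x => //; apply: later => // B BV /neq_index neqB.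
    have [->|neqB0] := eqVneq B B0; first by exists z.
    have [y yB] := meetI B BV neqB0; exists y; first by case/setDP: yB.
    exact: cliqueV xI yB.
  have [x xA] := meetI A AV neqA; exists x; first by case/setDP: xA.
  apply: later => //; first by case/setDP: xA.
  move=> B BV ltB; have [|y yB] := meetI B BV.
    by apply: contraTneq ltB => ->; rewrite -leqNgt.
  exists y; first by case/setDP: yB.
  exact: cliqueV AV BV (neq_index _ _ ltB) xA yB.
have {}meetI A : A \in V -> exists x, x \in A :\: I.
  by move=> AV; apply/set0Pn; rewrite setD_eq0 meetI.
(* No part is exceptional in this case; [set0] is a dummy value. *)
exists set0 => A AV _; have [x xA] := meetI A AV.
exists x; first by case/setDP: xA.
apply: later => // [|B BV /neq_index neqB]; first by case/setDP: xA.
have [y yB] := meetI B BV; exists y; first by case/setDP: yB.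
exact: cliqueV xA yB.
Qed.

Variable h : nat.

(** With h + 2 parts or more, each non-exceptional part would contain a vertex with neighbours in
    more than h parts, hence of degree above h, and there would be more than h such vertices. *)
Lemma transitive_partition_size (V : seq {set T}) :
  #|[set x | h < #|e x|]| <= h -> transitive_partition e V -> size V <= h.+1.
Proof.
move=> few trV; have [B0 allB0] := transitive_partition_all_but_one trV.
have /and3P[uV /and3P[_ tV _] _] := trV.
(* An inequality only, because [B] may fail to be a part. *)
have countD1 B : (size V).-1 <= count (predC1 B) V.
  have := count_predC (pred1 B) V; rewrite count_uniq_mem //.
  by case: (B \in V) => /= <-; rewrite ?add1n ?add0n ?leq_pred.
rewrite leqNgt; apply/negP => ltV.
suff : h < #|[set x | h < #|e x|]| by rewrite ltnNge few.
suff ltX : (size V).-1 <= #|[set x | h < #|e x|]|.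
  by apply: leq_trans ltX; case: (size V) ltV.
apply: leq_trans (countD1 B0) _; apply: count_meeting => // A AV neqA.
have [x xA nbr] := allB0 A AV neqA; exists x; rewrite // inE.
have ltC : h < count (predC1 A) V.
  by apply: leq_trans (countD1 A); case: (size V) ltV.
apply: leq_trans ltC _; rewrite -cardsE; apply: count_meeting => // B BV neqB.
by have [y yB exy] := nbr B BV neqB; exists y; rewrite // inE.
Qed.

(** Ties at degree exactly h may be broken in any way, so the program can fill [Q] in a single
    scan. *)
Lemma top_degrees_clique (Q : {set T}) :
  #|Q| = h -> {in Q, forall x, h <= #|e x|} ->
  (forall x, h < #|e x| -> x \in Q) ->
  {in Q &, forall x y, x != y -> e x y}.
Proof.
move=> cardQ Qh hQ; have [I [indep clique]] := split_graphP.
have nbrC q : q \in I -> e q \subset ~: I.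
  move=> qI; apply/subsetP => y eqy; rewrite in_setC.
  by apply/negP => yI; move/negP: (indep q y qI yI).
(* If a vertex q of Q in I missed some q' in Q, all neighbours of q would have
   degree greater than h, so Q would contain q and its h neighbours. *)
suff inI q q' : q \in Q -> q' \in Q -> q' != q -> q \in I -> e q q'.
  move=> x y xQ yQ neq; have [xI|xC] := boolP (x \in I).
    by apply: inI; rewrite // eq_sym.
  have [yI|yC] := boolP (y \in I); first by rewrite sym_e inI.
  by apply: clique; rewrite ?inE.
move=> qQ q'Q neq qI; apply/negPn/negP => nadj.
have hC : h <= #|~: I| := leq_trans (Qh q qQ) (subset_leq_card (nbrC q qI)).
suff NQ k : e q k -> h < #|e k|.
  have : q |: [set k | e q k] \subset Q.
    apply/subsetP => k; rewrite !inE => /predU1P[->//|/NQ]; exact: hQ.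
  move/subset_leq_card; rewrite cardsU1 inE irr_e /= cardQ cardsE.
  by rewrite add1n ltnNge Qh.
(* [k] is adjacent to [q] and to the rest of the clique side, so its degree is at least the size of
   that side, which is at least h. If that size is exactly h, vertices of [Q] in [I] are adjacent to
   the whole clique side; [q'] is such a vertex, as [q] misses it, and gives [k] one more
   neighbour. *)
move=> eqk; have kC : k \in ~: I by apply: (subsetP (nbrC q qI)).
have nbrk : q |: (~: I :\ k) \subset e k.
  apply/subsetP => y; rewrite in_setU1 in_setD1 => /predU1P[->|/andP[neqy yC]].
    by rewrite unfold_in sym_e.
  by apply: clique; rewrite // eq_sym.
have cardk : #|q |: (~: I :\ k)| = #|~: I|.
  by rewrite cardsU1 !inE qI andbF (cardsD1 k (~: I)) kC.
have [ltC|leC] := ltnP h #|~: I|.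
  by apply: leq_trans ltC _; rewrite -cardk subset_leq_card.
have full x : x \in Q -> x \in I -> e x =i ~: I.
  move=> xQ xI; apply/subset_cardP; last exact: nbrC.
  by apply/eqP; rewrite eqn_leq subset_leq_card ?nbrC // (leq_trans leC) ?Qh.
have q'I : q' \in I.
  by apply: contraR nadj; rewrite -in_setC -(full q).
have q'k : e k q' by rewrite sym_e -[e _ _]/(k \in e q') full.
have : q' |: (q |: (~: I :\ k)) \subset e k.
  by apply/subsetP => y; rewrite in_setU1 => /predU1P[->//|/(subsetP nbrk)].
move/subset_leq_card; apply: leq_trans.
by rewrite cardsU1 cardk !inE (negPf neq) q'I andbF add1n ltnS.
Qed.

(** Rank 0 is the complement of [Q], and ranks 1 to h number the vertices of [Q]. The hypotheses
    match what the invariant [ranking] of the program provides. *)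
Lemma rank_transitive_partition (rank : T -> nat) :
  h < #|T| -> (forall x, rank x <= h) ->
  (forall i, 0 < i <= h -> exists x, rank x = i) ->
  (forall x y, 0 < rank x -> rank x = rank y -> x = y) ->
  (forall x, 0 < rank x -> h <= #|e x|) ->
  (forall x, h < #|e x| -> 0 < rank x) ->
  transitive_partition e [seq [set x | rank x == i] | i <- iota 0 h.+1].
Proof.
move=> ltT rank_le rank_onto rank_inj Qh hQ.
pose Q := [set x | 0 < rank x].
have cardQ : #|Q| = h.
  have uQ : uniq [seq rank x | x in Q].
    rewrite map_inj_in_uniq ?enum_uniq // => x y; rewrite mem_enum inE => x0 _.
    exact: rank_inj.
  rewrite -(size_iota 1 h) -(size_image rank Q).
  apply/perm_size/uniq_perm => // [|i]; first exact: iota_uniq.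
  rewrite mem_iota add1n ltnS; apply/imageP/idP => [[x]|ih].
    by rewrite inE => x0 ->; rewrite x0 rank_le.
  have [x xi] := rank_onto i ih; exists x; rewrite // inE xi.
  by case/andP: ih.
have cliqueQ : {in Q &, forall x y, x != y -> e x y}.
  apply: top_degrees_clique => // x; rewrite ?inE; [exact: Qh|exact: hQ].
have [x0 rank0] : exists x, rank x = 0.
  have /set0Pn[x] : ~: Q != set0 by rewrite -card_gt0 cardsCs setCK cardQ subn_gt0.
  by rewrite !inE -eqn0Ngt => /eqP; exists x.
have onto i : i < h.+1 -> exists x, rank x = i.
  by case: i => [|i] ih; [exists x0|exact: rank_onto].
apply/and3P; split.
- rewrite map_inj_in_uniq ?iota_uniq // => i j; rewrite !mem_iota !add0n.
  move=> ih _ /setP eqij; have [x xi] := onto i ih.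
  by have := eqij x; rewrite !inE xi eqxx => /esym/eqP.
- apply/and3P; split.
  + apply/eqP/setP => x; rewrite in_setT; apply/bigcupP.
    exists [set y | rank y == rank x]; rewrite in_set ?eqxx //.
    by apply: map_f; rewrite mem_iota ltnS rank_le.
  + apply/trivIsetP => A B; rewrite !in_set => /mapP[i _ ->] /mapP[j _ ->] neq.
    rewrite -setI_eq0; apply/eqP/setP => x; rewrite !inE.
    apply: contraNF neq => /andP[/eqP<- /eqP<-]; exact: eqxx.
  + rewrite in_set; apply/mapP => -[i]; rewrite mem_iota add0n => /onto[x xi].
    by move/setP/(_ x); rewrite !inE xi eqxx.
- rewrite pairwise_map.
  apply: (@sub_in_pairwise _ (fun i => i < h.+1) ltn); first last.
  + by rewrite -(sorted_pairwise ltn_trans) iota_ltn_sorted.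
  + by apply/allP => i; rewrite mem_iota.
  move=> i j; rewrite -!topredE => /= ih jh ltij.
  apply/forall_inP => y; rewrite inE => /eqP yj.
  have yQ : y \in Q by rewrite inE yj (leq_ltn_trans _ ltij).
  case: i ih ltij => [_ j0|i ih ltij].
    (* [y] has at least h neighbours, but [Q] has only h - 1 vertices besides [y]. *)
    have /subsetPn[x eyx xQ] : ~~ (e y \subset Q :\ y).
      apply: contraL (Qh y _) => [/subset_leq_card leQ|]; last by rewrite yj.
      by rewrite -ltnNge (leq_ltn_trans leQ) // -cardQ (cardsD1 y Q) yQ.
    apply/exists_inP; exists x; last by rewrite sym_e.
    have neqxy : x != y by apply: contraTneq eyx => ->; rewrite unfold_in irr_e.
    by move: xQ; rewrite !inE neqxy -eqn0Ngt.
  have [x xi] := rank_onto i.+1 ih; apply/exists_inP; exists x.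
    by rewrite inE xi.
  apply: cliqueQ => //; first by rewrite inE xi.
  by apply: contraTneq ltij => eqxy; rewrite -xi -yj eqxy ltnn.
Qed.

End SplitGraph.
(** * Reasoning on programs *)

(** [T] is only an upper bound on the time, so that branches of different lengths share one
    bound. *)
Definition runs (w : nat) (p : cmd) (s : state) (T : nat) (Q : state -> Prop) :=
  exists t s', [/\ exec w p s t s', t <= T & Q s'].

Lemma runs_seq w p q s T1 T2 (P Q : state -> Prop) :
  runs w p s T1 P -> (forall s', P s' -> runs w q s' T2 Q) ->
  runs w (Seq p q) s (T1 + T2) Q.
Proof.
move=> [t1 [s1 [run1 le1 Ps1]]] /(_ s1 Ps1)[t2 [s2 [run2 le2 Qs2]]].
by exists (t1 + t2), s2; rewrite leq_add //; split=> //; apply: exec_seq run2.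
Qed.

Lemma runs_leq w p s T1 T2 Q :
  T1 <= T2 -> runs w p s T1 Q -> runs w p s T2 Q.
Proof.
by move=> leT [t [s' [run_p let1 Qs']]]; exists t, s'; rewrite (leq_trans let1).
Qed.

(* Meant for loop-free programs only, whence [False] on loops. *)
Fixpoint wp (w : nat) (p : cmd) (s : state) (Q : state -> Prop) : Prop :=
  match p with
  | Skip => Q s
  | Const x c => c < w /\ Q (set_reg s x c)
  | Move x y => Q (set_reg s x (reg s y))
  | Add x y z => reg s y + reg s z < w /\ Q (set_reg s x (reg s y + reg s z))
  | Defs.Sub x y z => Q (set_reg s x (reg s y - reg s z))
  | Read x a y => Q (set_reg s x (arr s a (reg s y)))
  | Write a x y => Q (set_arr s a (reg s x) (reg s y))
  | Seq p q => wp w p s (fun s' => wp w q s' Q)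
  | If x y p q => if reg s x < reg s y then wp w p s Q else wp w q s Q
  | While _ _ _ => False
  end.

Fixpoint cost (p : cmd) : nat :=
  match p with
  | Seq p q => cost p + cost q
  | If _ _ p q => (maxn (cost p) (cost q)).+1
  | _ => 1
  end.

Lemma runs_wp w p s Q : wp w p s Q -> runs w p s (cost p) Q.
Proof.
elim: p s Q => [|x c|x y|x y z|x y z|x a y|a x y|p IHp q IHq|x y p IHp q IHq|//]
  s Q /=.
- by exists 1, s; split=> //; constructor.
- by case=> ltc Qs; exists 1, (set_reg s x c); split=> //; constructor.
- by exists 1, (set_reg s x (reg s y)); split=> //; constructor.
- by case=> lt_w Qs; exists 1, (set_reg s x (reg s y + reg s z)); split=> //;
     constructor.
- by exists 1, (set_reg s x (reg s y - reg s z)); split=> //; constructor.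
- by exists 1, (set_reg s x (arr s a (reg s y))); split=> //; constructor.
- by exists 1, (set_arr s a (reg s x) (reg s y)); split=> //; constructor.
- by move=> /IHp run_p; apply: runs_seq run_p _ => s'; apply: IHq.
- have run_if r : runs w r s (cost r) Q ->
      r = (if reg s x < reg s y then p else q) ->
      runs w (If x y p q) s (maxn (cost p) (cost q)).+1 Q.
    move=> [t [s' [run_r let1 Qs']]] def_r; exists t.+1, s'; split=> //.
      by apply: exec_if; rewrite -def_r.
    by rewrite ltnS (leq_trans let1) // def_r; case: ifP; rewrite leq_max leqnn ?orbT.
  by case: ifP => lt_xy; [move/IHp|move/IHq] => /run_if; apply; rewrite lt_xy.
Qed.

(** Induction on the bound [k] on the variant [mu]: each iteration costs its body and a test, and
    the failing test adds the last unit. *)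
Lemma runs_while w x y p (I : state -> Prop) (mu : state -> nat) k s
    (Q : state -> Prop) :
  (forall s1, I s1 -> reg s1 x < reg s1 y ->
     wp w p s1 (fun s2 => I s2 /\ mu s2 < mu s1)) ->
  (forall s1, I s1 -> reg s1 y <= reg s1 x -> Q s1) ->
  I s -> mu s <= k -> runs w (While x y p) s (k * (cost p).+1).+1 Q.
Proof.
move=> body stop; elim: k s => [|k IHk] s Is lek;
  have [lt_xy|le_yx] := ltnP (reg s x) (reg s y).
- have [t [s1 [_ _ [_]]]] := runs_wp (body s Is lt_xy).
  by rewrite ltnNge (leq_trans lek).
- by exists 1, s; split=> //; [apply: exec_while_stop|apply: stop].
- have [t1 [s1 [run1 le1 [Is1 lt1]]]] := runs_wp (body s Is lt_xy).
  have [|t2 [s2 [run2 le2 Qs2]]] := IHk s1 Is1; first by rewrite -ltnS (leq_trans lt1).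
  exists (t1 + t2).+1, s2; split=> //; first exact: exec_while_step run1 run2.
  by rewrite ltnS mulSn addSn; lia.
- by exists 1, s; split=> //; [apply: exec_while_stop|apply: stop].
Qed.

Local Notation rN := 0.
Local Notation rOne := 1.
Local Notation rU := 2.
Local Notation rTmp := 3.
Local Notation rDeg := 4.
Local Notation rH := 5.
Local Notation rCount := 6.
Local Notation rFill := 7.
Local Notation rRank := 8.
Local Notation rZero := 9.
Local Notation rNext := 10.
Local Notation aOff := 0.
Local Notation aRank := 2.
Local Notation aHist := 3.

(** * The algorithm *)

Definition load_degree : cmd :=
  Seq (Read rTmp aOff rU)
  (Seq (Add rNext rU rOne)
  (Seq (Read rDeg aOff rNext)
  (Defs.Sub rDeg rDeg rTmp))).

Definition histogram_body : cmd :=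
  Seq load_degree
  (Seq (Read rTmp aHist rDeg)
  (Seq (Add rTmp rTmp rOne)
  (Seq (Write aHist rDeg rTmp)
  (Move rU rNext)))).

Definition h_index_body : cmd :=
  Seq (Defs.Sub rH rH rOne)
  (Seq (Read rTmp aHist rH)
  (Add rCount rCount rTmp)).

Definition select : cmd :=
  Seq (Write aRank rU rRank) (Add rRank rRank rOne).

(* [rFill] is the number of vertices of degree exactly h still to be selected. *)
Definition ranking_body : cmd :=
  Seq load_degree
  (Seq (If rH rDeg select
       (If rDeg rH Skip
       (If rZero rFill (Seq (Defs.Sub rFill rFill rOne) select) Skip)))
  (Move rU rNext)).

(* Register [rZero] is never written. *)
Definition split_transitivity : cmd :=
  Seq (Const rOne 1)
  (Seq (While rU rN histogram_body)
  (Seq (Move rH rN)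
  (Seq (While rCount rH h_index_body)
  (Seq (Seq (Read rTmp aHist rH)
       (Seq (Defs.Sub rCount rCount rTmp)
       (Seq (Defs.Sub rFill rH rCount)
       (Seq (Const rU 0)
       (Const rRank 1)))))
  (Seq (While rU rN ranking_body)
  (If rZero rN (Move rN rRank) Skip)))))).

(** * Correctness and running time of the algorithm *)

Section Correctness.

Variables (w n : nat) (off : nat -> nat).
Let deg u := off u.+1 - off u.
Hypothesis ltnw : n.+1 < w.
Hypothesis deg_lt : forall u, u < n -> deg u < n.

(** The restriction to vertices below [k] describes the histogram array in the middle of its
    loop. *)
Definition hist k j := \sum_(0 <= u < k) (deg u == j).
Definition card_ge j := \sum_(0 <= u < n) (j <= deg u).

Lemma hist_le k j : hist k j <= k.
Proof.
rewrite /hist; apply: leq_trans (leq_sum _ (fun _ _ => leq_b1 _)) _.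
by rewrite sum_nat_const_nat muln1 subn0.
Qed.

Lemma card_ge_le j : card_ge j <= n.
Proof.
rewrite /card_ge; apply: leq_trans (leq_sum _ (fun _ _ => leq_b1 _)) _.
by rewrite sum_nat_const_nat muln1 subn0.
Qed.

Lemma card_geS j : card_ge j = card_ge j.+1 + hist n j.
Proof.
rewrite /card_ge /hist -big_split /=; apply: eq_bigr => u _.
by case: ltngtP.
Qed.

Lemma card_ge_n : card_ge n = 0.
Proof.
rewrite /card_ge big_nat_cond big1 // => u /andP[/andP[_ ltun] _].
by rewrite leqNgt deg_lt.
Qed.

(** What every loop preserves. *)
Definition frame (s : state) :=
  [/\ reg s rN = n, reg s rOne = 1, reg s rZero = 0 & arr s aOff = off].

Lemma histogram_correct s :
  frame s -> reg s rU = 0 -> reg s rCount = 0 ->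
  arr s aHist = (fun=> 0) -> arr s aRank = (fun=> 0) ->
  runs w (While rU rN histogram_body) s (n * (cost histogram_body).+1).+1
    (fun s' => [/\ frame s', reg s' rCount = 0, arr s' aRank = (fun=> 0) &
       forall j, arr s' aHist j = hist n j]).
Proof.
move=> fr u0 c0 hist0 rank0.
pose I s := [/\ frame s, reg s rU <= n /\ reg s rCount = 0,
  arr s aRank = (fun=> 0) & forall j, arr s aHist j = hist (reg s rU) j].
have Is : I s.
  by split; rewrite ?u0 // => j; rewrite hist0 /hist big_nil.
apply: (@runs_while _ _ _ _ I (fun s => n - reg s rU)); first last.
- by rewrite u0 subn0.
- exact: Is.
- move=> s' [[HN H1 H0 Ho] [le' c'] r' h'] ge'; split=> // j; rewrite h'.
  by congr hist; apply/eqP; rewrite eqn_leq le' -HN ge'.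
move=> {fr u0 c0 hist0 rank0 Is}s [[HN H1 H0 Ho] [leu c0] rank0 Hh] ltu.
rewrite /= /upd /= Ho H1 addn1 -/(deg _) Hh.
rewrite HN in ltu; have hle := hist_le (reg s rU) (deg (reg s rU)).
split; first by lia.
split; first by lia.
split; last by lia.
split=> //= j; rewrite /upd /hist big_nat_recr //= -!/(hist _ _).
rewrite Hh [deg _ == j]eq_sym; case: eqVneq => [->|_] //; by rewrite addn0.
Qed.

(** The candidate h descends from n, with [rCount] the number of vertices of degree at least h. All
    larger values have been rejected, so the first accepted one is the h-index, as the last
    inequalities say. *)
Lemma h_index_correct s :
  frame s -> reg s rH = n -> reg s rCount = 0 -> arr s aRank = (fun=> 0) ->
  (forall j, arr s aHist j = hist n j) ->
  runs w (While rCount rH h_index_body) s (n * (cost h_index_body).+1).+1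
    (fun s' => [/\ frame s', arr s' aRank = (fun=> 0),
       forall j, arr s' aHist j = hist n j, reg s' rCount = card_ge (reg s' rH) &
       card_ge (reg s' rH).+1 <= reg s' rH <= card_ge (reg s' rH)]).
Proof.
move=> fr hn c0 rank0 Hh.
pose I s := [/\ frame s, arr s aRank = (fun=> 0),
  forall j, arr s aHist j = hist n j, reg s rCount = card_ge (reg s rH) &
  forall j, reg s rH < j -> card_ge j < j].
have Is : I s.
  split; rewrite ?hn ?c0 ?card_ge_n // => j ltnj.
  exact: leq_ltn_trans (card_ge_le j) ltnj.
apply: (@runs_while _ _ _ _ I (fun s => reg s rH)); first last.
- by rewrite hn.
- exact: Is.
- move=> s' [fr' r' h' c' gt'] ge'; split=> //; rewrite -c' ge' andbT.
  by rewrite -ltnS gt'.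
move=> {fr hn c0 rank0 Hh Is}s [[HN H1 H0 Ho] rank0 Hh c gt] ltc.
rewrite /= /upd /= H1 subn1 Hh c.
(* The loop test excludes h = 0, so the subtraction is not truncated. *)
case: (reg s rH) ltc c gt => // h ltc c gt; rewrite /= -card_geS.
split; first exact: leq_ltn_trans (card_ge_le h) (ltnW ltnw).
split=> //; split=> // j /=; rewrite /upd /=.
by rewrite leq_eqVlt => /predU1P[<-|/gt//]; rewrite -c.
Qed.

(* [rk] is the content of the output array when the vertices below [u] have been
   treated; a vertex is selected when its rank is positive. *)
Record ranking (h u r : nat) (rk : nat -> nat) : Prop := Ranking {
  rank_out : forall v, u <= v -> rk v = 0;
  rank_lt : forall v, rk v < r;
  rank_onto : forall i, 0 < i < r -> exists2 v, v < u & rk v = i;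
  rank_inj : forall v v', 0 < rk v -> rk v = rk v' -> v = v';
  rank_deg : forall v, 0 < rk v -> h <= deg v;
  rank_pos : forall v, v < u -> h < deg v -> 0 < rk v }.

Lemma ranking0 h : ranking h 0 1 (fun=> 0).
Proof. by split=> //; case. Qed.

Lemma ranking_skip h u r rk :
  deg u <= h -> ranking h u r rk -> ranking h u.+1 r rk.
Proof.
move=> le_h [out lt onto inj rdeg pos]; split=> //.
- by move=> v /ltnW/out.
- by move=> i /onto[v ltv <-]; exists v; rewrite // ltnW.
- move=> v; rewrite ltnS leq_eqVlt => /predU1P[->|/pos//].
  by rewrite ltnNge le_h.
Qed.

Lemma ranking_select h u r rk :
  h <= deg u -> ranking h u r rk -> ranking h u.+1 r.+1 (upd rk u r).
Proof.
move=> le_h [out lt onto inj rdeg pos].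
have r_gt0 : 0 < r by apply: leq_ltn_trans (lt 0).
split; rewrite /upd.
- by move=> v ltv; rewrite gtn_eqF // out // ltnW.
- by move=> v; case: ifP => // _; rewrite ltnW // ltnS.
- move=> i /andP[i0]; rewrite ltnS leq_eqVlt => /predU1P[->|ltir].
    by exists u; rewrite ?eqxx.
  have [|v ltv rkv] := onto i; first by rewrite i0.
  by exists v; rewrite ?(ltn_eqF ltv) // ltnW.
- move=> v v'; case: eqVneq => [->|_]; case: eqVneq => [->|_] //; last exact: inj.
    by move=> _ eqr; have := lt v'; rewrite -eqr ltnn.
  by move=> _ eqr; have := lt v; rewrite eqr ltnn.
- by move=> v; case: eqP => [->|_ /rdeg].
- move=> v; rewrite ltnS leq_eqVlt; case: eqP => //= _; exact: pos.
Qed.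

Lemma ranking_correct h s :
  frame s -> reg s rH = h -> reg s rU = 0 -> reg s rRank = 1 ->
  reg s rFill = h - card_ge h.+1 -> card_ge h.+1 <= h <= card_ge h -> h < w.-1 ->
  arr s aRank = (fun=> 0) ->
  runs w (While rU rN ranking_body) s (n * (cost ranking_body).+1).+1
    (fun s' => [/\ frame s', reg s' rRank = h.+1 & ranking h n h.+1 (arr s' aRank)]).
Proof.
move=> fr Hh u0 r1 f0 /andP[few many] lthw rank0.
(* The next rank, the ties still to be selected and the remaining vertices of degree above h always
   add up to h + 1, and enough ties remain. At the end both sums are empty, which forces [rFill] to
   be 0 and [rRank] to be h + 1. *)
pose I s := [/\ frame s, reg s rH = h /\ reg s rU <= n,
  reg s rRank + reg s rFill + \sum_(reg s rU <= v < n) (h < deg v) = h.+1,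
  reg s rFill <= \sum_(reg s rU <= v < n) (deg v == h) &
  ranking h (reg s rU) (reg s rRank) (arr s aRank)].
have Is : I s.
  split; rewrite ?u0 ?r1 ?f0 // ?rank0; last exact: ranking0.
    by rewrite -/(card_ge h.+1); lia.
  by rewrite -/(hist n h); move: many; rewrite card_geS; lia.
apply: (@runs_while _ _ _ _ I (fun s => n - reg s rU)); first last.
- by rewrite u0 subn0.
- exact: Is.
- move=> s' [[HN H1 H0 Ho] [_ leu] sum fill rk] ge'.
  have eqn : reg s' rU = n by apply/eqP; rewrite eqn_leq leu -HN ge'.
  move: fill sum rk; rewrite eqn !big_geq // leqn0 => /eqP->.
  by rewrite !addn0 => ->.
move=> {fr Hh u0 r1 f0 rank0 Is}s [[HN H1 H0 Ho] [Hh leu] sum fill rk] ltu.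
rewrite HN in ltu; rewrite (big_ltn ltu) in sum; rewrite (big_ltn ltu) in fill.
rewrite /= /upd /= Ho H1 addn1 -/(deg _) Hh H0.
split; first by lia.
have ltmu : n - (reg s rU).+1 < n - reg s rU by lia.
(* Whenever a vertex is selected, another term of the invariant sum is positive, so [rRank] is at
   most h and its increment stays below [w]. *)
case: (ltngtP h (deg (reg s rU))) sum fill => /= cmp sum fill.
- rewrite addn1; split; first by lia.
  split=> //; split=> //=; rewrite /upd /=; try lia.
  exact/ranking_select/rk/ltnW.
- split=> //; split=> //=; rewrite /upd /=.
  exact/ranking_skip/rk/ltnW.
case: ltnP => [fill0|fill0].
  rewrite addn1; split; first by lia.
  split=> //; split=> //=; rewrite /upd /=; try lia.
  by apply/ranking_select/rk; rewrite cmp.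
split=> //; split=> //=; rewrite /upd /=; try lia.
by apply/ranking_skip/rk; rewrite cmp.
Qed.

Lemma split_transitivity_correct s :
  reg s = (fun x => if x == rN then n else 0) -> arr s aOff = off ->
  arr s aHist = (fun=> 0) -> arr s aRank = (fun=> 0) ->
  runs w split_transitivity s (100 * n.+1)
    (fun s' => exists h, [/\ card_ge h.+1 <= h <= card_ge h,
       ranking h n h.+1 (arr s' aRank) &
       reg s' rN = if 0 < n then h.+1 else 0]).
Proof.
move=> regE offE hist0 rank0.
have w_gt1 : 1 < w by apply: leq_trans ltnw.
pose P1 s' := [/\ frame s', reg s' rU = 0, reg s' rCount = 0,
  arr s' aHist = (fun=> 0) & arr s' aRank = (fun=> 0)].
pose P3 s' := [/\ frame s', reg s' rH = n, reg s' rCount = 0,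
  arr s' aRank = (fun=> 0) & forall j, arr s' aHist j = hist n j].
pose P5 s' := let h := reg s' rH in
  [/\ frame s', reg s' rU = 0 /\ reg s' rRank = 1,
  reg s' rFill = h - card_ge h.+1, card_ge h.+1 <= h <= card_ge h &
  arr s' aRank = (fun=> 0)].
(* The time is accumulated by [runs_seq] and compared with the generous bound last; it amounts to
   25n + 12. *)
apply: runs_leq; last first.
- apply: (runs_seq (P := P1)).
    apply: runs_wp; rewrite /= /P1 /frame /= /upd /= regE /=; by split.
  move=> s1 [fr1 u1 c1 h1 r1].
  apply: runs_seq (histogram_correct fr1 u1 c1 h1 r1) _ => s2 [fr2 c2 r2 h2].
  apply: (runs_seq (P := P3)).
    by apply: runs_wp; have [HN ? ? ?] := fr2; rewrite /= /P3 /frame /= /upd /=.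
  move=> s3 [fr3 hn3 c3 r3 h3].
  apply: runs_seq (h_index_correct fr3 hn3 c3 r3 h3) _.
  move=> s4 [fr4 r4 h4 c4 idx4].
  apply: (runs_seq (P := P5)).
    apply: runs_wp; have [HN ? ? ?] := fr4.
    (* Removing the vertices of degree h from [rCount] leaves those of larger degree; [rFill] is
       what they lack to reach h. *)
    rewrite /= /P5 /frame /= /upd /= h4 c4 card_geS addnK.
    split; first exact: ltnW.
    by split=> //; split=> //; rewrite -card_geS.
  move=> s5 [fr5 [u5 rk5] f5 idx5 r5].
  have lth : reg s5 rH < w.-1.
    have := card_ge_le (reg s5 rH); case/andP: idx5; lia.
  apply: runs_seq (ranking_correct fr5 erefl u5 rk5 f5 idx5 lth r5) _.
  move=> s6 [[HN H1 H0 Ho] rk6 rank6].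
  apply: runs_wp; rewrite /= H0 HN.
  case: ltnP => [_|n0].
    by exists (reg s5 rH); split.
  exists (reg s5 rH); split=> //=.
  by apply/eqP; rewrite -leqn0.
by rewrite /=; lia.
Qed.

End Correctness.

(** * Degrees read off the offsets *)

Section Degrees.

Variables (n : nat) (e : rel 'I_n) (L : 'I_n -> seq 'I_n).
Hypotheses (irr_e : irreflexive e) (adjL : adjacency_lists e L).

Let off := arr (input L) 0.

(** Consecutive prefix sums differ by the length of the list of [u], which has no duplicates. *)
Lemma input_degree (u : 'I_n) : off u.+1 - off u = #|e u|.
Proof.
have [uL eL] := adjL u; rewrite /off /= ltn_ord (ltnW (ltn_ord u)).
rewrite (bigD1 u) ?ltnSn //=.
under eq_bigl => v do rewrite ltnS andbC -ltn_neqAle.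
by rewrite addnK -(eq_card eL) (card_uniqP uL).
Qed.

Lemma card_geE j : card_ge n off j = #|[set u | j <= #|e u|]|.
Proof.
rewrite /card_ge big_mkord -sum1_card [RHS]big_mkcond /=.
by apply: eq_bigr => u _; rewrite inE input_degree; case: leq.
Qed.

Lemma input_degree_lt u : u < n -> off u.+1 - off u < n.
Proof.
move=> ltun; have /= -> := input_degree (Ordinal ltun).
rewrite -[X in _ < X]card_ord.
have := max_card (predU1 (Ordinal ltun) (e (Ordinal ltun))).
by rewrite cardU1 -topredE /= irr_e.
Qed.

End Degrees.

(** * From the algorithm to the transitivity *)

Lemma transitive_partition_le_card (T : finType) (e : rel T) V :
  transitive_partition e V -> size V <= #|T|.
Proof.
case/and3P=> uV /and3P[_ tV nV0] _; rewrite -(count_predT V) -cardsT.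
apply: count_meeting => // A AV _.
have /set0Pn[x xA] : A != set0 by apply: contraNneq nV0 => <-; rewrite inE.
by exists x.
Qed.

Lemma transitivity_eq (T : finType) (e : rel T) (V : seq {set T}) :
  transitive_partition e V ->
  (forall W, transitive_partition e W -> size W <= size V) ->
  transitivity e = size V.
Proof.
move=> trV max_V; apply/eqP; rewrite eqn_leq; apply/andP; split.
  by apply/bigmax_leqP => i /existsP[W /max_V]; rewrite size_tuple.
have ltV : size V < #|T|.+1 by rewrite ltnS (transitive_partition_le_card trV).
apply: (leq_bigmax_cond (Ordinal ltV) (F := fun i => val i)).
by apply/existsP; exists (in_tuple V).
Qed.

Lemma transitive_partition_nil (T : finType) (e : rel T) :
  #|T| = 0 -> transitive_partition e [::].
Proof.
move=> T0; apply/and3P; split=> //; apply/and3P; split.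
- by apply/eqP/setP => x; have := card0_eq T0 x.
- by apply/trivIsetP => A B; rewrite in_set.
- by rewrite in_set.
Qed.

Theorem theorem1 :
  exists (p : cmd) (c b : nat),
    forall (n : nat) (e : rel 'I_n) (L : 'I_n -> seq 'I_n),
      symmetric e -> irreflexive e -> split_graph e ->
      adjacency_lists e L ->
      let m := #|edges e| in
      exists (t : nat) (s : state),
        [/\ exec ((n + m + 2) ^ b) p (input L) t s,
            t <= c * (n + m + 1),
            reg s 0 = transitivity e &
            transitive_partition e (output_parts n s)].
Proof.
(* Exponent 1 suffices because the program is correct for every word bound above n + 1. *)
exists split_transitivity, 100, 1 => n e L sym_e irr_e split_e adjL m.
have ltw : n.+1 < (n + m + 2) ^ 1 by rewrite expn1; lia.
have [t [s [run_p let1 [h [idx rank_h reg0]]]]] :=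
  split_transitivity_correct ltw (input_degree_lt irr_e adjL)
    (erefl : reg (input L) = _) erefl erefl erefl.
have size_out : size (output_parts n s) = reg s 0 by rewrite size_map size_iota.
suff [trV max_V] : transitive_partition e (output_parts n s) /\
    forall W, transitive_partition e W -> size W <= reg s 0.
  exists t, s; split=> //; first by apply: leq_trans let1 _; lia.
  by rewrite -size_out (transitivity_eq trV) // size_out.
(* The empty graph has transitivity 0 rather than h + 1. *)
have [n0|n_gt0] := posnP n.
  have T0 : #|'I_n| = 0 by rewrite card_ord.
  have {}reg0 : reg s 0 = 0 by rewrite reg0 [in 0 < n]n0.
  rewrite /output_parts reg0; split.
    exact: transitive_partition_nil.
  by move=> W /transitive_partition_le_card; rewrite T0.
rewrite n_gt0 in reg0; rewrite /output_parts reg0.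
have [few many] := andP idx.
(* h = n would require n vertices of degree at least n. The strict inequality makes the part of rank
   0 nonempty. *)
have ltn : h < n.
  have := leq_trans many (card_ge_le n (arr (input L) 0) h).
  rewrite leq_eqVlt => /predU1P[eqh|//]; move: many.
  by rewrite eqh (card_ge_n (input_degree_lt irr_e adjL)) leqNgt n_gt0.
split; last first.
  by move=> W; apply: transitive_partition_size => //; rewrite -(card_geE adjL).
have [_ lt onto inj rdeg pos] := rank_h.
apply: (rank_transitive_partition sym_e irr_e split_e) => //.
- by rewrite card_ord.
- by move=> v; rewrite -ltnS lt.
- by move=> i; rewrite -ltnS => /onto[v ltv <-]; exists (Ordinal ltv).
- by move=> u v u0 /(inj _ _ u0)/val_inj.
- by move=> v /rdeg; rewrite (input_degree adjL).
- by move=> v ltv; apply: pos; rewrite // (input_degree adjL).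
Qed.
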